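(* Let $q$ be a prime with $q\equiv 3\pmod 4$ and $m\ge 2$ an integer. Then the line graph $L(\Gamma(\mathbb{Z}_{q^m}[i]))$ is pancyclic.
   Context: $\mathbb{Z}_n[i]=\mathbb{Z}[i]/\langle n\rangle=\{a+bi : a,b\in\mathbb{Z}_n\}$ with $i^2=-1$. For a finite commutative ring $R$ with unity, $\Gamma(R)$ has vertex set the nonzero zero-divisors of $R$, distinct $x,y$ adjacent iff $xy=0$. The line graph $L(G)$ has the edges of $G$ as vertices, two being adjacent iff they share an endpoint in $G$. A graph of order $N$ is pancyclic if $N\ge 3$ and it contains a cycle of length $k$ for every $3\le k\le N$. *)

(* Defs.v *)
From HB Require Import structures.
From mathcomp Require Import all_boot all_order all_algebra.
From mathcomp Require Import ring.

Set Implicit Arguments.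
Unset Strict Implicit.
Unset Printing Implicit Defensive.

Import GRing.Theory.
Local Open Scope ring_scope.

(* [Gauss a b] is a + b i. As ['Z_n] is Z/nZ only for n > 1, [gaussZ n] is
   Z_n[i] only for n > 1. *)
Record gaussZ (n : nat) : predArgType := Gauss { gre : 'Z_n; gim : 'Z_n }.

Section GaussRing.
Variable n : nat.
Implicit Types x y z : gaussZ n.

Definition gauss_pair x : 'Z_n * 'Z_n := (gre x, gim x).
Definition pair_gauss (p : 'Z_n * 'Z_n) : gaussZ n := Gauss p.1 p.2.

Lemma gauss_pairK : cancel gauss_pair pair_gauss.
Proof. by case. Qed.

HB.instance Definition _ := Equality.copy (gaussZ n) (can_type gauss_pairK).
HB.instance Definition _ := Choice.copy (gaussZ n) (can_type gauss_pairK).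
HB.instance Definition _ := Countable.copy (gaussZ n) (can_type gauss_pairK).
HB.instance Definition _ : isFinite (gaussZ n) := CanIsFinite gauss_pairK.

Definition gauss0 : gaussZ n := Gauss 0 0.
Definition gauss1 : gaussZ n := Gauss 1 0.
Definition gaussi : gaussZ n := Gauss 0 1.
Definition gauss_opp x : gaussZ n := Gauss (- gre x) (- gim x).
Definition gauss_add x y : gaussZ n := Gauss (gre x + gre y) (gim x + gim y).
Definition gauss_mul x y : gaussZ n :=
  Gauss (gre x * gre y - gim x * gim y) (gre x * gim y + gim x * gre y).

Lemma gauss_addA : associative gauss_add.
Proof. by move=> x y z; rewrite /gauss_add /= !addrA. Qed.

Lemma gauss_addC : commutative gauss_add.
Proof. by move=> x y; congr Gauss; apply: addrC. Qed.

Lemma gauss_add0 : left_id gauss0 gauss_add.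
Proof. by case=> a b; rewrite /gauss_add /= !add0r. Qed.

Lemma gauss_addN : left_inverse gauss0 gauss_opp gauss_add.
Proof. by case=> a b; rewrite /gauss_add /= !addNr. Qed.

HB.instance Definition _ := GRing.isZmodule.Build (gaussZ n)
  gauss_addA gauss_addC gauss_add0 gauss_addN.

Lemma gauss_mulA : associative gauss_mul.
Proof. by move=> x y z; congr Gauss => /=; ring. Qed.

Lemma gauss_mulC : commutative gauss_mul.
Proof. by move=> x y; congr Gauss => /=; ring. Qed.

Lemma gauss_mul1 : left_id gauss1 gauss_mul.
Proof. by case=> a b; congr Gauss => /=; ring. Qed.

Lemma gauss_mulD : left_distributive gauss_mul gauss_add.
Proof. by move=> x y z; congr Gauss => /=; ring. Qed.

Lemma gauss_1neq0 : gauss1 != gauss0.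
Proof. by []. Qed.

HB.instance Definition _ := GRing.Zmodule_isComNzRing.Build (gaussZ n)
  gauss_mulA gauss_mulC gauss_mul1 gauss_mulD gauss_1neq0.

Lemma gaussi2 : gaussi * gaussi = -1.
Proof. by congr Gauss => /=; ring. Qed.

End GaussRing.

Record sgraph := SGraph {
  vertex :> finType;
  adj : rel vertex;
  adj_sym : symmetric adj;
  adj_irr : irreflexive adj
}.

Section ZeroDivisorGraph.
Variable R : finComNzRingType.

Definition zero_divisor (x : R) : bool :=
  [exists y : R, (y != 0) && (x * y == 0)].

Definition zd_vertex : finType := {x : R | (x != 0) && zero_divisor x}.

Definition zd_adj : rel zd_vertex :=
  [rel x y | (x != y) && (val x * val y == 0)].

Lemma zd_adj_sym : symmetric zd_adj.
Proof. by move=> x y; rewrite /zd_adj /= eq_sym mulrC. Qed.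

Lemma zd_adj_irr : irreflexive zd_adj.
Proof. by move=> x; rewrite /zd_adj /= eqxx. Qed.

Definition zero_divisor_graph : sgraph := SGraph zd_adj_sym zd_adj_irr.

End ZeroDivisorGraph.

Section LineGraph.
Variable G : sgraph.

Definition is_edge (e : {set G}) : bool :=
  [exists x : G, exists y : G, adj x y && (e == [set x; y])].

Definition line_vertex : finType := {e : {set G} | is_edge e}.

Definition line_adj : rel line_vertex :=
  [rel e f | (e != f) && (val e :&: val f != set0)].

Lemma line_adj_sym : symmetric line_adj.
Proof. by move=> e f; rewrite /line_adj /= eq_sym setIC. Qed.

Lemma line_adj_irr : irreflexive line_adj.
Proof. by move=> e; rewrite /line_adj /= eqxx. Qed.

Definition line_graph : sgraph := SGraph line_adj_sym line_adj_irr.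

End LineGraph.

(* A repetition-free closed walk on k vertices is a k-cycle only for k >= 3. *)
Definition has_cycle (G : sgraph) (k : nat) : Prop :=
  exists2 c : seq G, size c = k & ucycle (@adj G) c.

Definition pancyclic (G : sgraph) : Prop :=
  (3 <= #|G|)%N /\ forall k : nat, (3 <= k <= #|G|)%N -> has_cycle G k.

(* Main.v *)
(** Since q is inert in Z[i], a zero divisor of Z_(q^m)[i] is a multiple of q;
    hence v = q^(m-1) is adjacent to every other vertex of the zero-divisor
    graph, and there are at least 4 vertices.  The line graph of any such graph
    is pancyclic.  The edges through v form a clique of the line graph, which
    gives the short cycles.  A cycle containing all of these edges but missing
    the edge xy can be lengthened by xy: if two consecutive edges of the cycle
    meet in x (or in y), insert xy between them; otherwise the neighbours of vx
    and of vy on the cycle all contain v, so that vy can be moved next to vx and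
    xy inserted between the two. *)

Require Import Defs.
From mathcomp Require Import all_boot all_order all_algebra.
From mathcomp Require Import cyclic zify ring.

Set Implicit Arguments.
Unset Strict Implicit.
Unset Printing Implicit Defensive.

Import GRing.Theory.

(** * Rotations and consecutive entries of cyclic sequences *)

Section CycleSeq.
Variable T : eqType.
Implicit Types (r : rel T) (c s : seq T).

Lemma rot_next c f : uniq c -> 1 < size c -> f \in c ->
  exists i s, rot i c = [:: f, next c f & s].
Proof.
move=> Uc c2 /rot_to [i s rotE]; exists i.
have: size (rot i c) = size c by rewrite size_rot.
rewrite -(next_rot i Uc) rotE; case: s {rotE} => [|g s] /= sz.
  by rewrite -sz in c2.
by exists s; rewrite eqxx.
Qed.

Lemma cycle_neq r c : uniq c -> 1 < size c -> cycle r c ->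
  cycle [rel f g | (f != g) && r f g] c.
Proof.
move=> Uc c2 Cc; apply: cycle_from_next => // f fc /=.
rewrite (next_cycle Cc fc) andbT.
have [i [s rotE]] := rot_next Uc c2 fc.
move: Uc; rewrite -(rot_uniq i) rotE /= inE negb_or.
by case/andP=> /andP[].
Qed.

Lemma not_cycle_rot r c : uniq c -> 1 < size c -> ~~ cycle r c ->
  exists i f g s, rot i c = [:: f, g & s] /\ ~~ r f g.
Proof.
move=> Uc c2 nC.
have [/allP all_r|] := boolP (all (fun f => r f (next c f)) c).
  by rewrite cycle_from_next in nC.
rewrite -has_predC => /hasP [f fc /= nr].
by have [i [s ?]] := rot_next Uc c2 fc; exists i, f, (next c f), s.
Qed.

End CycleSeq.

(** * Line graphs of graphs with a dominating vertex *)

Section DominatingVertex.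
Variables (G : sgraph) (v : G).
Hypothesis dom_v : forall x : G, x != v -> adj v x.

Local Notation L := (line_graph G).
Implicit Types (e f g : L) (c : seq L) (x y : G).

(** Adjacency of the line graph without distinctness, which [cycle_neq] restores on repetition-free
    cycles of length at least 2. *)
Definition meets : rel L := [rel e f | val e :&: val f != set0].

Lemma meetsP x e f : x \in val e -> x \in val f -> meets e f.
Proof. by move=> xe xf; apply/set0Pn; exists x; rewrite inE xe. Qed.

Lemma edge_ends e : exists x y, adj x y /\ val e = [set x; y].
Proof.
case: e => e /= /existsP [x /existsP [y /andP[xy /eqP ->]]].
by exists x, y.
Qed.

Lemma star_edge x : x != v -> {e : L | val e = [set v; x]}.
Proof.
move=> xv; have ie : is_edge [set v; x].
  by apply/existsP; exists v; apply/existsP; exists x; rewrite dom_v ?eqxx.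
by exists (Sub [set v; x] ie).
Qed.

Lemma ucycle_line c : uniq c -> 1 < size c -> cycle meets c ->
  ucycle (@adj L) c.
Proof. by move=> Uc c2 Cc; apply/andP; split=> //; apply: cycle_neq. Qed.

Definition star : seq L := enum [pred e : L | v \in val e].

Lemma mem_star e : (e \in star) = (v \in val e).
Proof. by rewrite mem_enum. Qed.

Lemma cycle_star c : {subset c <= star} -> uniq c -> cycle meets c.
Proof.
move=> cS Uc; apply: cycle_from_next => // f fc.
by apply: (@meetsP v); rewrite -mem_star cS // mem_next.
Qed.

(** By domination, each [x != v] yields the edge [{v, x}], and distinct [x] yield distinct edges. *)
Lemma size_star : #|G|.-1 <= size star.
Proof.
pose F (e : L) : {set G} := val e.
have sub : {subset [seq [set v; x] | x <- enum [pred x | x != v]]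
            <= map F star}.
  move=> A /mapP [x]; rewrite mem_enum inE => xv ->.
  have [e eE] := star_edge xv.
  by apply/mapP; exists e => //; rewrite mem_star eE set21.
have /uniq_leq_size/(_ sub) : uniq [seq [set v; x] | x <- enum [pred x | x != v]].
  rewrite map_inj_in_uniq ?enum_uniq // => x y.
  rewrite !mem_enum !inE => xv yv /setP /(_ x).
  by rewrite !inE eqxx orbT (negPf xv) /= => /esym /eqP.
by rewrite !size_map -cardE (cardC1 v).
Qed.

(** The only ends of [e] are [v] and [x]; once [x] is excluded, the common vertex must be [v]. *)
Lemma meets_star e f x : val e = [set v; x] -> meets e f ->
  x \notin val e :&: val f -> v \in val f.
Proof.
move=> eE /set0Pn [z]; rewrite eE !inE orbC eqxx orbT /=.
by case/andP=> /orP [] /eqP -> // ->.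
Qed.

Lemma insert_edge c e : uniq c -> 1 < size c -> cycle meets c ->
    {subset star <= c} -> e \notin c ->
  exists c', [/\ uniq c', cycle meets c', {subset star <= c'}
               & size c' = (size c).+1].
Proof.
move=> Uc c2 Cc Sc ec.
have ve : v \notin val e by apply: contra ec => ve; apply: Sc; rewrite mem_star.
have [x [y [xy eE]]] := edge_ends e.
have [xe ye] : x \in val e /\ y \in val e by rewrite eE set21 set22.
have xv : x != v by apply: contraNneq ve => <-.
have yv : y != v by apply: contraNneq ve => <-.
have xDy : x != y by apply: contraTneq xy => ->; rewrite adj_irr.
(* Consecutive edges of [c] meet, so [r] fails for them exactly when they share [x] or [y]; then [e]
   fits between them. *)
pose r := [rel f g : L | [&& meets f g, x \notin val f :&: val g
                           & y \notin val f :&: val g]].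
have [Cr|nCr] := boolP (cycle r c); last first.
  have [i [f [g [s [rotE]]]]] := not_cycle_rot Uc c2 nCr.
  rewrite -(size_rot i c) -(mem_rot i c) in ec *.
  rewrite -(rot_uniq i) in Uc; rewrite -(rot_cycle i) in Cc; move=> nr.
  have {}Sc : {subset star <= rot i c} by move=> h /Sc; rewrite mem_rot.
  rewrite {}rotE in Uc Cc Sc ec *.
  have /andP [fg gs] : meets f g && path meets g (rcons s f) by [].
  have [ef eg] : meets f e /\ meets e g.
    move: nr; rewrite /= fg /= negb_and !negbK.
    by case/orP=> /setIP [h1 h2]; split;
      [apply: meetsP xe|apply: meetsP h2|apply: meetsP ye|apply: meetsP h2].
  exists [:: f, e, g & s]; split=> //.
  - move: Uc ec; rewrite /= !inE !negb_or => /and3P[/andP[-> ->] -> ->].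
    by case/and3P=> ef' -> ->; rewrite eq_sym ef'.
  - by rewrite /= ef eg.
  - by move=> h /Sc; rewrite !inE => /or3P [] ->; rewrite ?orbT.
have [ex exE] := star_edge xv; have [ey eyE] := star_edge yv.
have exc : ex \in c by apply: Sc; rewrite mem_star exE set21.
have eyc : ey \in c by apply: Sc; rewrite mem_star eyE set21.
have exDey : ex != ey.
  apply: contraNneq xDy => exey; have := set22 v x.
  by rewrite -exE exey eyE !inE (negPf xv).
have r_sym f g : r f g = r g f by rewrite /r /meets /= setIC.
have rx f : r ex f -> v \in val f.
  by case/and3P=> /(meets_star exE) /[apply].
have ry f : r ey f -> v \in val f.
  by case/and3P=> /(meets_star eyE) h _ /h.
have vx : v \in val ex by rewrite exE set21.
have vy : v \in val ey by rewrite eyE set21.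
have [i s rotE] := rot_to exc.
rewrite -(size_rot i c); rewrite -(mem_rot i) in ec; rewrite -(mem_rot i) in eyc.
rewrite -(rot_uniq i) in Uc; rewrite -(rot_cycle i) in Cr.
have {}Sc : {subset star <= rot i c} by move=> h /Sc; rewrite mem_rot.
rewrite {}rotE in Uc Cr Sc ec eyc *.
move: eyc; rewrite inE eq_sym (negPf exDey) /= => /splitPr def_s.
case: s / def_s Uc Cr Sc ec => s1 s2 Uc Cr Sc ec.
(* [ey] moves up next to [ex] with [e] in between: [ex] and [e] share [x], [e] and [ey] share
   [y]. *)
have P : perm_eq [:: ex, e, ey & s1 ++ s2] (e :: ex :: s1 ++ ey :: s2).
  apply/permP=> p; rewrite /= !count_cat /=.
  by rewrite addnCA; congr (_ + (_ + _)); rewrite addnCA.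
exists [:: ex, e, ey & s1 ++ s2]; split.
- by rewrite (perm_uniq P) cons_uniq ec.
- have me f g : r f g -> meets f g by case/and3P.
  have mp f s : path r f s -> path meets f s by apply: sub_path.
  rewrite /= (meetsP _ xe) ?exE ?set22 //= (meetsP ye) ?eyE ?set22 //=.
  move: Cr; rewrite /= rcons_cat cat_path /= => /and3P [p1 l1 p2].
  rewrite rcons_cat cat_path.
  (* The gap left by [ey] closes through [v]. For empty [s1] the edge before the gap is now [ey]
     itself. *)
  have l1v : v \in val (last ey s1).
    case/lastP: s1 {Uc Sc ec P p1} l1 => [|s1 z] //.
    by rewrite !last_rcons => h; apply: ry; rewrite r_sym.
  apply/andP; split.
    case: s1 {Uc Sc ec P l1 l1v} p1 => [|z s1] //= /andP [/rx vz /mp ->].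
    by rewrite (meetsP vy vz).
  case: s2 {Uc Sc ec P} p2 => [|z s2] /=; first by rewrite (meetsP l1v vx).
  by case/andP=> /ry vz /mp ->; rewrite (meetsP l1v vz).
- by move=> h /Sc hc; rewrite (perm_mem P) inE hc orbT.
- by rewrite (perm_size P).
Qed.

Lemma pancyclic_line_dominating : 4 <= #|G| -> pancyclic (line_graph G).
Proof.
(* Four vertices give three edges through [v], so the clique already contains a triangle. *)
move=> G4; have S3 : 3 <= size star.
  by apply: leq_trans size_star; rewrite -ltnS prednK //; apply: leq_trans G4.
have SL : size star <= #|L| by rewrite -cardE max_card.
split=> [|k /andP [k3 kL]]; first exact: leq_trans SL.
have [kS|/ltnW Sk] := leqP k (size star).
  exists (take k star); first exact: size_takel.
  have Ut : uniq (take k star) by rewrite take_uniq ?enum_uniq.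
  apply: ucycle_line; rewrite ?size_takel //; first exact: ltnW.
  by apply: cycle_star => // e /mem_take.
(* Keeping [star] inside the cycle is the invariant that lets [insert_edge] apply again. *)
suff [c [Uc Cc _ szc]] : exists c, [/\ uniq c, cycle meets c,
    {subset star <= c} & size c = k].
  by exists c => //; apply: ucycle_line; rewrite // szc ltnW.
(* The case of length 0 is void because [star] has at least 3 edges; the induction really starts at
   [size star]. *)
elim: k Sk kL {k3} => [|k IHk]; first by rewrite leqNgt (leq_trans _ S3).
rewrite leq_eqVlt => /predU1P [<- _|].
  by exists star; split; rewrite ?cycle_star ?enum_uniq.
rewrite ltnS => Sk kL; have [c [Uc Cc Sc szc]] := IHk Sk (ltnW kL).
have [e ec] : exists e, e \notin c.
  apply/existsP; rewrite -negb_forall; apply/forallP => Lc.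
  have : #|L| <= size c.
    by rewrite cardE uniq_leq_size ?enum_uniq // => e _; apply: Lc.
  by rewrite szc leqNgt kL.
rewrite -szc; apply: insert_edge ec => //.
by rewrite szc; apply: leq_trans Sk; apply: ltnW.
Qed.

End DominatingVertex.

(** * Sums of two squares modulo a prime congruent to 3 modulo 4 *)

Lemma dvdn_add_exp_odd d a b k : odd k -> d %| a + b -> d %| a ^ k + b ^ k.
Proof.
move=> odd_k dab; rewrite -(odd_double_half k) odd_k add1n.
(* The exponent grows by two at each step, through an identity that avoids subtraction in [nat]. *)
elim: (k./2) => [|j IHj]; first by rewrite !expn1.
rewrite doubleS; set n := (j.*2).+1 in IHj *.
have : d %| (a + b) * (a ^ n.+1 + b ^ n.+1) by rewrite dvdn_mulr.
have -> : (a + b) * (a ^ n.+1 + b ^ n.+1)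
          = a * b * (a ^ n + b ^ n) + (a ^ n.+2 + b ^ n.+2).
  by rewrite !expnS; ring.
by rewrite dvdn_addr // dvdn_mull.
Qed.

(** As [(q - 1) / 2] is odd, [q] divides [a ^ (q - 1) + b ^ (q - 1)]. If [q] divided neither [a] nor
    [b], this sum would be 2 modulo [q] by Fermat, but [q > 2]. *)
Lemma prime_3mod4_dvd_sqr q a b : prime q -> q = 3 %[mod 4] ->
  q %| a ^ 2 + b ^ 2 -> (q %| a) && (q %| b).
Proof.
move=> q_pr q4 qab.
have [qa|qNa] := boolP (q %| a).
  by move: qab; rewrite dvdn_addr ?Euclid_dvdX ?qa //= => /andP[].
have qNb : ~~ (q %| b).
  apply: contra qNa => qb.
  by move: qab; rewrite dvdn_addl ?Euclid_dvdX ?qb //= => /andP[].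
have qE : q = (q %/ 4) * 4 + 3 by rewrite {1}(divn_eq q 4) q4.
have q1E : q.-1 = 2 * (q %/ 4).*2.+1 by lia.
have /(dvdn_add_exp_odd (k := (q %/ 4).*2.+1)) := qab.
rewrite /= odd_double -!expnM -q1E -(totient_prime q_pr) => /(_ isT).
rewrite /dvdn -modnDm !Euler_exp_totient ?(coprime_sym _ q) ?prime_coprime //.
by rewrite modnDm -/(dvdn q 2) => /dvdn_leq h; have := h isT; lia.
Qed.

Local Open Scope ring_scope.

Lemma Zp_nat_eq0 n k : (1 < n)%N -> (k%:R == 0 :> 'Z_n) = (n %| k)%N.
Proof. by move=> n1; rewrite -val_eqE /= val_Zp_nat. Qed.

(* Rocq's injection tactic would go on to unfold equalities in ['Z_n] to nat. *)
Lemma Gauss_inj n (a b c d : 'Z_n) : Gauss a b = Gauss c d -> a = c /\ b = d.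
Proof.
by move=> E; split; [have := congr1 (@gre n) E | have := congr1 (@gim n) E].
Qed.

(** * Zero divisors of Z_(q^m)[i] *)

Section GaussPrimePower.
Variables q m : nat.
Hypotheses (q_pr : prime q) (q4 : (q = 3 %[mod 4])%N) (m2 : (2 <= m)%N).

Local Notation n := (q ^ m)%N.
Local Notation R := (gaussZ n).

Let n_gt1 : (1 < n)%N.
Proof. by rewrite -(exp1n m) ltn_exp2r ?prime_gt1 // ltnW. Qed.

(** A generator of the annihilator of [q], the socle of Z_(q^m). *)
Definition qtop : 'Z_n := (q ^ m.-1)%:R.

Lemma qtop_mul (a : 'Z_n) : (q %| a)%N -> qtop * a = 0.
Proof.
move=> qa; apply/eqP; rewrite -[a]natr_Zp -natrM Zp_nat_eq0 //.
by rewrite -[in X in (X %| _)%N](ltn_predK m2) expnSr dvdn_mul.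
Qed.

Lemma qtop_natr_eq0 k : (qtop * k%:R == 0) = (q %| k)%N.
Proof.
rewrite -natrM Zp_nat_eq0 // -[in X in (X %| _)%N](ltn_predK m2) expnSr.
by rewrite dvdn_pmul2l // expn_gt0 prime_gt0.
Qed.

(** Rests on [m.-1 > 0]; with [qtop_mul] it makes [qtop] square to zero. *)
Lemma dvd_qtop : (q %| (qtop : nat))%N.
Proof.
rewrite /qtop val_Zp_nat // /dvdn modn_dvdm ?dvdn_exp // 1?ltnW //.
by rewrite -/(dvdn _ _) dvdn_exp // -ltnS (ltn_predK m2).
Qed.

(** If [q] does not divide the norm [a ^ 2 + b ^ 2], the norm is a unit, and multiplying [x * y = 0]
    by the conjugate of [x] forces [y = 0]. *)
Lemma zero_divisor_gauss (x : R) : zero_divisor x ->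
  (q %| gre x)%N && (q %| gim x)%N.
Proof.
case: x => a b /existsP [y /andP [y0 /eqP xy0]] /=.
apply: prime_3mod4_dvd_sqr => //; apply: contraNT y0 => qN.
pose N : 'Z_n := a * a + b * b.
have NE : N = (a ^ 2 + b ^ 2)%:R.
  by rewrite natrD !natrX !natr_Zp !expr2.
have N_unit : N \is a GRing.unit.
  by rewrite NE unitZpE // coprime_pexpl ?prime_coprime // ltnW.
have : Gauss a (- b) * (Gauss a b * y) = 0 by rewrite xy0 mulr0.
have -> : Gauss a (- b) * (Gauss a b * y) = Gauss (N * gre y) (N * gim y).
  by congr Gauss; rewrite /N /=; ring.
case/Gauss_inj=> h1 h2; case: y h1 h2 {xy0} => c d /= h1 h2.
by apply/eqP; congr Gauss; apply: (mulrI N_unit); rewrite ?h1 ?h2 mulr0.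
Qed.

Lemma qtop_gauss_mul (x : R) : zero_divisor x -> Gauss qtop 0 * x = 0.
Proof.
case/zero_divisor_gauss/andP=> /qtop_mul h1 /qtop_mul h2.
by congr Gauss; rewrite /= ?h1 ?h2 mul0r ?subr0 ?addr0.
Qed.

Lemma qtop_neq0 : qtop != 0.
Proof.
by rewrite -[qtop]mulr1 (qtop_natr_eq0 1) dvdn1 neq_ltn prime_gt1 ?orbT.
Qed.

Let q_gt2 : (2 < q)%N.
Proof. by case: q q4 => [|[|[]]]. Qed.

Lemma qtop_natr_inj j k : (j < q)%N -> (k < q)%N ->
  qtop * j%:R = qtop * k%:R -> j = k.
Proof.
wlog kj : j k / (k <= j)%N.
  by move=> W jq kq E; case/orP: (leq_total k j) => /W; [|symmetry]; auto.
move=> jq _ /eqP; rewrite -subr_eq0 -mulrBr -natrB // qtop_natr_eq0.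
by rewrite /dvdn modn_small; lia.
Qed.

(** Distinct for distinct pairs with [j, k < q], these elements supply the vertices to be
    counted. *)
Definition socle_elt (j k : nat) : R := Gauss (qtop * j%:R) (qtop * k%:R).

(** Multiplication by [qtop] kills them. The case [j = k = 0] is allowed, as [zero_divisor] does not
    exclude 0. *)
Lemma zero_divisor_socle j k : zero_divisor (socle_elt j k).
Proof.
apply/existsP; exists (Gauss qtop 0); apply/andP; split.
  by apply: contraNneq qtop_neq0 => /Gauss_inj [-> _].
apply/eqP; congr Gauss; rewrite /= ?mulr0 ?subr0 ?add0r mulrAC qtop_mul ?mul0r //;
exact: dvd_qtop.
Qed.

Lemma dominating_zero_divisor :
  exists v : zero_divisor_graph R, forall x, x != v -> adj v x.
Proof.
have v0 : (Gauss qtop 0 != 0 :> R) && zero_divisor (Gauss qtop 0 : R).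
  have := zero_divisor_socle 1 0; rewrite /socle_elt mulr1 mulr0 => ->.
  by rewrite andbT; apply: contraNneq qtop_neq0 => /Gauss_inj [-> _].
exists (exist (fun x : R => (x != 0) && zero_divisor x) _ v0) => x; rewrite /= /zd_adj /= eq_sym => -> /=.
by apply/eqP/qtop_gauss_mul; case: x => x /= /andP [].
Qed.

Lemma card_zero_divisor_graph : (4 <= #|zero_divisor_graph R|)%N.
Proof.
(* The entry 2 is admissible because [q > 2]. *)
pose t : seq (nat * nat) := [:: (1, 0); (0, 1); (1, 1); (2, 0)]%N.
pose F p := socle_elt p.1 p.2.
(* Since [F] sends [(0, 0)] to 0, including this pair makes injectivity also show that the four
   elements are nonzero. *)
have F_inj p p' : p \in (0, 0)%N :: t -> p' \in (0, 0)%N :: t ->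
    F p = F p' -> p = p'.
  have small u : u \in (0, 0)%N :: t -> (u.1 < q)%N && (u.2 < q)%N.
    by rewrite !inE => /or4P [|||/orP []] /eqP -> /=; lia.
  case: p p' => [j k] [j' k'] /small /andP [? ?] /small /andP [? ?].
  by case/Gauss_inj=> /= /qtop_natr_inj -> // /qtop_natr_inj ->.
have t_sub : {subset t <= (0, 0)%N :: t} by move=> p pt; apply/orP; right.
have Us : uniq (map F t).
  by rewrite map_inj_in_uniq // => p p' /t_sub ? /t_sub; apply: F_inj.
rewrite /= card_sig cardE -[4%N]/(size (map F t)) uniq_leq_size // => x.
case/mapP=> p pt ->; rewrite mem_enum inE zero_divisor_socle andbT.
have F00 : F (0, 0)%N = 0 by congr Gauss; rewrite mulr0.
rewrite -F00; apply/eqP => /(F_inj _ _ (t_sub _ pt) (mem_head _ _)) p0.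
by rewrite p0 in pt.
Qed.

End GaussPrimePower.

Local Close Scope ring_scope.

Theorem theorem3p8 (q m : nat) (hq : prime q) (hq4 : q = 3 %[mod 4])
    (hm : 2 <= m) :
  pancyclic (line_graph (zero_divisor_graph (gaussZ (q ^ m)))).
Proof.
have [v dom_v] := dominating_zero_divisor hq hq4 hm.
exact: (pancyclic_line_dominating dom_v (card_zero_divisor_graph hq hq4 hm)).
Qed.
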